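(* Let $X$ be a reflexive Banach space and let $Z$ be a Hausdorff, locally convex topological vector space, let $C\subseteq Z$ be a convex, pointed cone, and let $K$ be a nonempty, convex and closed subset of $X$. Let $D\subseteq K$ be a self segment-dense set in $K$ in the weak topology of $X$, and consider a mapping $f:K\times K\to Z$ satisfying (i) for all $y\in D$, the mapping $x\mapsto f(x,y)$ is strongly $C$-upper semicontinuous on $K$ in the weak topology of $X$; (ii) for all $x\in K$, the mapping $y\mapsto f(x,y)$ is strongly $C$-upper semicontinuous on $K\setminus D$ in the weak topology of $X$; (iii) for all $x\in K$, the mapping $y\mapsto f(x,y)$ is $C$-convex on $D$; (iv) for all $x\in D$, $f(x,x)\notin -C\setminus\{0\}$; (v) there exists $r>0$ such that for all $x\in K$ with $\|x\|\le r$ there exists $y_0\in D$ with $\|y_0\|<r$ such that $f(x,y_0)\in -C$. Then there exists $x_0\in K$ such that $f(x_0,y)\notin -C\setminus\{0\}$ for all $y\in K$.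
   Context: All vector spaces are real. $\operatorname{cl}$ denotes closure. $-C\setminus\{0\}$ denotes $(-C)\setminus\{0\}=-(C\setminus\{0\})$. The interior of $C$ is allowed to be empty. A set $C\subseteq Z$ is a cone if $tc\in C$ for all $c\in C$ and $t\ge 0$; it is convex if $C+C=C$, and pointed if $C\cap(-C)=\{0\}$. Write $z_1\le z_2$ iff $z_2-z_1\in C$. Strong $C$-upper semicontinuity: a map $g:K\to Z$ is strongly $C$-upper semicontinuous at $x\in K$ if for any $k\in C\setminus\{0\}$ there exists a neighborhood $U$ of $x$ such that $g(u)\in g(x)+k-(C\setminus\{0\})$ for all $u\in U\cap K$. It is strongly $C$-upper semicontinuous on a subset $S\subseteq K$ if it is so, as a map on $K$, at every point of $S$. ''In the weak topology of $X$'' means that the neighborhoods $U$ are taken in the weak topology of $X$. $C$-convexity: for a (not necessarily convex) set $D$, $g$ is $C$-convex on $D$ if for all $n\in\mathbb N$, $x_1,\dots,x_n\in D$ and $\lambda_1,\dots,\lambda_n\ge 0$ with $\sum_{i=1}^n\lambda_i=1$ such that $\sum_{i=1}^n\lambda_i x_i\in D$, one has $g\left(\sum_{i=1}^n\lambda_i x_i\right)\le\sum_{i=1}^n\lambda_i g(x_i)$. Self segment-dense set: let $U\subseteq V\subseteq X$ with $V$ convex. $U$ is self segment-dense in $V$ if $U$ is dense in $V$ (i.e. $V\subseteq\operatorname{cl}U$) and for all $x,y\in U$ the set $[x,y]\cap U$ is dense in $[x,y]$, where $[x,y]=\{x+t(y-x):t\in[0,1]\}$. ''In the weak topology'' means that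 closures are taken in the weak topology of $X$.
   Formalization: Condition (v) additionally requires that some x in K has norm at most r; without this (v) can hold vacuously and the claim fails, e.g. X=Z=R, C=[0,∞), K=D=[1,∞), f(x,y)=x−y, r=1/2. *)

(* Defs.v *)
(* Analysis over an abstract [R : realType], with MathComp-Analysis. *)
From HB Require Import structures.
From mathcomp Require Import all_boot all_order all_algebra.
From mathcomp Require Import all_classical all_reals all_analysis.

Set Implicit Arguments.
Unset Strict Implicit.
Unset Printing Implicit Defensive.

Import Order.TTheory GRing.Theory Num.Theory.
Import numFieldNormedType.Exports.

Local Open Scope classical_set_scope.
Local Open Scope ring_scope.

Section Dual.
Context {R : realType} {X : normedModType R}.

Definition dual_pred : {pred X -> R^o} :=
  fun f => `[< linear f /\ continuous f >].

Lemma dual_predP (f : X -> R^o) :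
  reflect (linear f /\ continuous f) (f \in dual_pred).
Proof. exact: asboolP. Qed.

Lemma dual_submod_closed : submod_closed dual_pred.
Proof.
split.
  apply/dual_predP; split; last by move=> x; exact: cvg_cst.
  by move=> a x y /=; rewrite scaler0 addr0.
move=> a f g /dual_predP[lf cf] /dual_predP[lg cg]; apply/dual_predP; split.
  move=> b x y; rewrite [LHS]/(a *: f (b *: x + y) + g (b *: x + y)) lf lg.
  rewrite -[RHS]/(b *: (a *: f x + g x) + (a *: f y + g y)).
  by rewrite !scalerDr !scalerA (mulrC a b) addrACA.
move=> x; apply: (@cvgD _ _ _ _ _ (a *: f) g); last exact: cg.
by apply: cvgZl_tmp; exact: cf.
Qed.

HB.instance Definition _ :=
  GRing.isSubmodClosed.Build R (X -> R^o) dual_pred dual_submod_closed.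

End Dual.

Record dual {R : realType} (X : normedModType R) := Dual {
  dual_fun :> X -> R^o ;
  dual_funP : dual_fun \in @dual_pred R X }.

HB.instance Definition _ (R : realType) (X : normedModType R) :=
  [isSub for @dual_fun R X].
HB.instance Definition _ (R : realType) (X : normedModType R) :=
  [Choice of dual X by <:].
HB.instance Definition _ (R : realType) (X : normedModType R) :=
  [SubChoice_isSubLmodule of dual X by <:].

Section DualNorm.
Context {R : realType} {X : normedModType R}.
Implicit Types l : dual X.

Definition dual_norm l : R := sup [set `|l x| | x in [set x | `|x| <= 1]].

Lemma dual_linear l : linear l.
Proof. by have /dual_predP[] := dual_funP l. Qed.

Lemma dual_continuous l : continuous l.
Proof. by have /dual_predP[] := dual_funP l. Qed.

HB.instance Definition _ l :=
  @GRing.isLinear.Build R X R^o *:%R (dual_fun l) (@dual_linear l).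

Lemma dual_norm_has_sup l :
  has_sup [set `|l x| | x in [set x | `|x| <= 1]].
Proof.
split; first by exists `|l 0|, 0 => //=; rewrite normr0.
have /linear_bounded_continuous/bounded_funP/(_ 1)[M lM] := @dual_continuous l.
by exists M => _ [x /= x1 <-]; exact: lM.
Qed.

Lemma dual_norm_ub l x : `|x| <= 1 -> `|l x| <= dual_norm l.
Proof. by move=> x1; apply: sup_ubound; [case: (dual_norm_has_sup l)|exists x]. Qed.

Lemma dual_norm_ge0 l : 0 <= dual_norm l.
Proof. by apply: le_trans (@dual_norm_ub l 0 _); rewrite ?normr0. Qed.

Lemma dual_norm_le l M :
  (forall x, `|x| <= 1 -> `|l x| <= M) -> dual_norm l <= M.
Proof.
move=> lM; apply: ge_sup; first by case: (dual_norm_has_sup l).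
by move=> _ [x /= x1 <-]; exact: lM.
Qed.

Lemma dual_normD l m : dual_norm (l + m) <= dual_norm l + dual_norm m.
Proof.
apply: dual_norm_le => x x1; rewrite -[X in `|X|]/(l x + m x).
by rewrite (le_trans (ler_normD _ _))// lerD// dual_norm_ub.
Qed.

Lemma dual_normZ (a : R) l : dual_norm (a *: l) = `|a| * dual_norm l.
Proof.
have le_normZ b k : dual_norm (b *: k) <= `|b| * dual_norm k.
  apply: dual_norm_le => x x1; rewrite -[X in `|X|]/(b * k x) normrM.
  by rewrite ler_wpM2l// dual_norm_ub.
apply/eqP; rewrite eq_le le_normZ/=.
have [->|a0] := eqVneq a 0; first by rewrite normr0 mul0r dual_norm_ge0.
have := le_normZ a^-1 (a *: l); rewrite scalerA mulVf// scale1r normfV.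
by rewrite ler_pdivlMl ?normr_gt0.
Qed.

Lemma dual_norm0_eq0 l : dual_norm l = 0 -> l = 0.
Proof.
move=> l0; apply/val_inj/funext => x; rewrite -[LHS]/(l x) -[RHS]/(0 : R).
have [->|x0] := eqVneq x 0; first exact: linear0.
have nx0 : `|x| != 0 by rewrite normr_eq0.
have : `|l (`|x|^-1 *: x)| <= dual_norm l.
  by apply: dual_norm_ub; rewrite normrZ normfV normr_id mulVf.
rewrite l0 normr_le0 linearZ/= => /eqP/(congr1 ( *:%R `|x|)).
by rewrite scalerA mulfV// scale1r scaler0.
Qed.

HB.instance Definition _ := @Lmodule_isNormed.Build R (dual X)
  dual_norm dual_normD dual_normZ dual_norm0_eq0.

End DualNorm.

(* [dual (dual X)] is the bidual with its norm topology; surjectivity of the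
   canonical embedding is stated pointwise. *)
Definition reflexive_space {R : realType} (X : normedModType R) :=
  forall phi : dual (dual X), exists x : X, forall l : dual X, phi l = l x.

(* The carrier [X] with the coarsest topology making every element of the
   topological dual continuous. *)
Definition weak {R : realType} (X : normedModType R) : Type :=
  initial_topology (fun x : X => (fun l => l x) : {ptws dual X -> R^o}).

HB.instance Definition _ (R : realType) (X : normedModType R) :=
  Topological.on (weak X).
HB.instance Definition _ (R : realType) (X : normedModType R) :=
  GRing.Lmodule.copy (weak X) X.

Section Cones.
Context {R : realType} {Z : lmodType R}.
Implicit Types C : set Z.

Definition is_cone C := forall (t : R) c, 0 <= t -> C c -> C (t *: c).

Definition convex_cone C := is_cone C /\ [set a + b | a in C & b in C] = C.

Definition pointed_cone C := C `&` (-%R @` C) = [set 0].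

Definition cone_le C (z1 z2 : Z) := C (z2 - z1).

Definition C_convex_on {X : lmodType R} C (D : set X) (g : X -> Z) :=
  forall (n : nat) (x : 'I_n -> X) (lam : 'I_n -> R),
    (forall i, D (x i)) -> (forall i, 0 <= lam i) ->
    \sum_(i < n) lam i = 1 -> D (\sum_(i < n) lam i *: x i) ->
    cone_le C (g (\sum_(i < n) lam i *: x i)) (\sum_(i < n) lam i *: g (x i)).

(* [g] stands for a map defined on [K]: its values outside [K] are ignored. *)
Definition strongly_C_usc_at (T : topologicalType) C (K : set T) (g : T -> Z)
    (x : T) :=
  forall k, (C `\ 0) k ->
    exists2 U, nbhs x U &
      forall u, (U `&` K) u -> [set g x + k - c | c in C `\ 0] (g u).

Definition strongly_C_usc_on (T : topologicalType) C (K S : set T)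
    (g : T -> Z) :=
  forall x, S x -> strongly_C_usc_at C K g x.

End Cones.

Definition lsegment {R : realType} {X : lmodType R} (x y : X) : set X :=
  [set x + t *: (y - x) | t in `[0, 1]%classic].

Definition self_segment_dense {R : realType} (T : preTopologicalLmodType R)
    (U V : set T) :=
  [/\ U `<=` V, V `<=` closure U &
      forall x y, U x -> U y ->
        lsegment x y `<=` closure (lsegment x y `&` U)].

Arguments strongly_C_usc_at {R Z} T C K g x.
Arguments strongly_C_usc_on {R Z} T C K S g.
Arguments self_segment_dense {R} T U V.

(* Main.v *)
Require Import Defs.
From mathcomp Require Import all_boot zify.

(** The set of [x] with [f x y] outside [-C \ {0}] is weakly closed in [K] for
    [y] in [D]; since [D] meets the convex hull of finitely many of its points
    in a weakly dense set, [C]-convexity makes these sets a KKM family. Hence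
    finitely many of them meet in the part of [K] in the ball of radius [r],
    which is weakly compact by reflexivity, so all of them with [|y| <= r] have
    a common point [x0] there. If [f x0 y] lay in [-C \ {0}] for another [y] in
    [D], so would [f x0 u] for points [u] of [D] on the segment from [y0] to [y]
    near [y0], which are in the ball; for [y] outside [D] use semicontinuity in
    [y] and density. The KKM theorem comes from Scarf's combinatorial lemma on
    a grid of the simplex, and Mazur's theorem from a minimal sublinear
    functional. *)

Set Implicit Arguments.
Unset Strict Implicit.
Unset Printing Implicit Defensive.

(** * Scarf's lemma *)

Lemma even_sum (J : finType) (P : pred J) (F : J -> nat) :
  (forall j, P j -> ~~ odd (F j)) -> ~~ odd (\sum_(j | P j) F j).
Proof.
move=> evenF; apply: (big_ind (fun m => ~~ odd m)) => // m n.
by rewrite oddD => /negPf-> /negPf->.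
Qed.

(* [e i] is a slack element: smallest in the order [i], above every non-slack
   element in the other orders. *)
Section Rooms.
Variables (I V : finType) (r : I -> V -> nat) (e : I -> V) (c : V -> I).
Hypothesis r_inj : forall i, injective (r i).
Hypothesis r_slack_min : forall i v, r i (e i) <= r i v.
Hypothesis r_slack_max : forall i j v, v \notin codom e -> j != i ->
  r i v < r i (e j).
Hypothesis c_slack : forall i, c (e i) = i.

(** Scarf's condition: no [v] beats, in every order at once, the least element of [S] for that
    order. *)
Definition dominant (S : {set V}) :=
  [forall v, exists i, forall x in S, r i v <= r i x].

Lemma dominantP (S : {set V}) :
  reflect (forall v, exists i, forall x, x \in S -> r i v <= r i x)
          (dominant S).
Proof.
apply: (iffP forallP) => domS v.
  by have /existsP[i /forall_inP] := domS v; exists i.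
by have [i iS] := domS v; apply/existsP; exists i; apply/forall_inP.
Qed.

Lemma dominantS (A B : {set V}) : A \subset B -> dominant B -> dominant A.
Proof.
move=> /subsetP AB /dominantP domB; apply/dominantP => v.
by have [i iB] := domB v; exists i => x /AB; exact: iB.
Qed.

Let slack_inj : injective e.
Proof. by move=> i j /(congr1 c); rewrite !c_slack. Qed.

(* Exactly one element of A is the minimum for two orders i and j; an extension
   takes over the minimum in one of them, and is then determined. *)
Lemma card_extensions_inner (A : {set V}) (t : V) :
  #|A|.+1 = #|I| -> t \in A -> t \notin codom e ->
  ~~ odd #|[set x | (x \notin A) && dominant (x |: A)]|.
Proof.
move=> cardA tA tNe; have [domA|NdomA] := boolP (dominant A); last first.
  rewrite (_ : [set x | _] = set0) ?cards0//; apply/setP => x.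
  rewrite !inE; apply: contraNF NdomA => /andP[_].
  by apply: dominantS; apply: subsetUr.
pose mu i := [arg min_(x < t in A) r i x].
have muA i : mu i \in A by rewrite /mu; case: arg_minnP.
have mu_min i x : x \in A -> r i (mu i) <= r i x.
  by rewrite /mu; case: arg_minnP => // y _ + xA; apply.
have mu_eq i x : x \in A -> (forall y, y \in A -> r i x <= r i y) -> mu i = x.
  by move=> xA xmin; apply: (@r_inj i); apply/eqP; rewrite eqn_leq mu_min// xmin.
have mu_onto x : x \in A -> exists i, mu i = x.
  move=> xA; have [i ix] := dominantP _ domA x.
  by exists i; apply: mu_eq.
have muT (B : {set I}) : (forall x, x \in A -> exists2 i, i \in B & mu i = x) ->
    mu @: B = A.
  move=> Bonto; apply/eqP; rewrite eqEsubset; apply/andP; split.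
    by apply/subsetP => _ /imsetP[i _ ->].
  by apply/subsetP => x /Bonto[i iB <-]; exact: imset_f.
have mu_injD i : mu @: [set~ i] = A -> {in [set~ i] &, injective mu}.
  move=> im; apply/imset_injP; rewrite im.
  have := cardsC1 i; lia.
have [i [j [ij muij]]] : exists i j, i != j /\ mu i = mu j.
  have /injectivePn[i [j ij muij]] : ~~ injectiveb mu.
    apply/injectiveP => mu_inj.
    have : #|mu @: [set: I]| <= #|A|.
      by apply/subset_leq_card/subsetP => _ /imsetP[i _ ->].
    rewrite card_imset// cardsT; lia.
  by exists i, j.
have imD p q : p != q -> mu p = mu q -> mu @: [set~ p] = A.
  move=> pq mupq; apply: muT => x /mu_onto[k <-].
  have [->|kp] := eqVneq k p; last by exists k; rewrite // !inE.
  by exists q; rewrite // !inE eq_sym.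
have mu_injNi := mu_injD _ (imD _ _ ij muij).
have mu_injNj : {in [set~ j] &, injective mu}.
  by apply: mu_injD; apply: (imD j i); rewrite // eq_sym.
have pairE p q : p != q -> mu p = mu q -> (p == i) || (p == j).
  move=> pq mupq; apply/negPn; rewrite negb_or; apply/negP => /andP[pi pj].
  have [qi|qi] := eqVneq q i.
    have qj : q != j by rewrite qi.
    by have := mu_injNj p q; rewrite !inE pj qj => /(_ isT isT mupq); apply/eqP.
  by have := mu_injNi p q; rewrite !inE pi qi => /(_ isT isT mupq); apply/eqP.
(* [M p] holds the points above all the minima of [A] except perhaps the one for [p]; extending [A]
   by such a point can change only the minimum for [p]. *)
pose M p := [set y | [forall (k | k != p), r k (mu k) < r k y]].
have MP p y : reflect (forall k, k != p -> r k (mu k) < r k y) (y \in M p).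
  by rewrite inE; apply: forall_inP.
(* The non-slack [t] keeps [mu k] below [e p] for [k] other than [p], so [M p] is nonempty and has a
   highest point [a p] in the order [p]. *)
have eM p : e p \in M p.
  apply/MP => k kp; apply: leq_ltn_trans (mu_min k t tA) _.
  by apply: r_slack_max; rewrite // eq_sym.
pose a p := [arg max_(y > e p in M p) r p y].
have aM p : a p \in M p by rewrite /a; case: arg_maxnP.
have a_max p y : y \in M p -> r p y <= r p (a p).
  by rewrite /a; case: arg_maxnP => // z _ + yM; apply.
have domA_M v p : v \in M p -> forall x, x \in A -> r p v <= r p x.
  move=> /MP vM; have [k kA] := dominantP _ domA v.
  suff -> : p = k by [].
  apply/eqP; rewrite eq_sym; apply/negPn/negP => /vM.
  by rewrite ltnNge kA.
have a_ext p q : p != q -> mu p = mu q ->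
    (a p \notin A) && dominant (a p |: A).
  move=> pq mupq; apply/andP; split.
    apply/negP; rewrite -{1}(imD _ _ pq mupq) => /imsetP[k].
    rewrite !inE => kp ak; have /MP/(_ _ kp) := aM p.
    by rewrite ak ltnn.
  apply/dominantP => v; have [vM|] := boolP (v \in M p).
    exists p => x /setU1P[->|]; first exact: a_max.
    exact: domA_M.
  rewrite inE negb_forall => /existsP[k]; rewrite negb_imply -leqNgt.
  move=> /andP[kp vk]; exists k => x /setU1P[->|xA].
    by apply: leq_trans vk _; apply/ltnW; apply: (MP _ _ (aM p)).
  exact: leq_trans vk (mu_min _ _ xA).
(* A common value would lie above every minimum of [A], against dominance. *)
have aij : a i != a j.
  apply/eqP => aij; have [k kA] := dominantP _ domA (a i).
  have := kA _ (muA k); apply/negP; rewrite -ltnNge.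
  have [->|ki] := eqVneq k i; last exact: (MP _ _ (aM i)).
  by rewrite aij; exact: (MP _ _ (aM j)).
suff -> : [set x | (x \notin A) && dominant (x |: A)] = [set a i; a j].
  by rewrite cards2 aij.
apply/setP => x; rewrite in_set !inE; apply/idP/idP; last first.
  move=> /orP[/eqP ->|/eqP ->]; first exact: a_ext ij muij.
  by apply: (a_ext j i); rewrite // eq_sym.
move=> /andP[xNA /dominantP domxA].
have [p pA] := domxA x.
(* [N] collects the orders whose minimum survives the extension by [x]. Their minima still exhaust
   [A], so exactly one order [p] is lost; dominance then makes [x] the highest point of [M p], and
   [mu p] is attained twice. *)
pose N := [set k | r k (mu k) < r k x].
have imN : mu @: N = A.
  apply: muT => y yA; have [k ky] := domxA y.
  have muk : mu k = y.
    by apply: mu_eq => // z zA; apply: ky; rewrite !inE zA orbT.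
  exists k => //; rewrite inE muk ltn_neqAle ky ?setU11// andbT.
  by apply: contra xNA => /eqP/r_inj <-.
have pNN : p \notin N by rewrite inE -leqNgt pA// !inE muA orbT.
have NE : N = [set~ p].
  apply/eqP; rewrite eqEcard; apply/andP; split.
    by apply/subsetP => k kN; rewrite !inE; apply: contraNneq pNN => <-.
  have := leq_imset_card mu N; rewrite imN; have := cardsC1 p; lia.
have xM : x \in M p.
  apply/MP => k kp; have : k \in N by rewrite NE !inE.
  by rewrite inE.
have xa : x = a p.
  apply: (@r_inj p); apply/eqP; rewrite eqn_leq a_max//=.
  have [k kA] := domxA (a p).
  have [kp|kp] := eqVneq k p; first by move: kA; rewrite kp; apply; rewrite setU11.
  have /MP/(_ _ kp) := aM p.
  by rewrite ltnNge kA// !inE muA orbT.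
have : mu p \in mu @: [set~ p] by rewrite -NE imN.
move=> /imsetP[q]; rewrite !inE eq_sym => pq mupq.
by rewrite xa; move: (pairE _ _ pq mupq) => /orP[/eqP->|/eqP->];
  rewrite eqxx ?orbT.
Qed.

(** The only extension is by the highest non-slack element in the order [k]. A slack one would
    complete the set of all [e i], each of which is below [t] in its own order; with a non-slack
    one, the order [k] alone can bound the non-slack elements, since [e i] is lowest in every other
    order [i]. *)
Lemma card_extensions_outer (t : V) k : t \notin codom e ->
  #|[set x | (x \notin e @: [set~ k]) && dominant (x |: e @: [set~ k])]| = 1.
Proof.
move=> tNe; pose a := [arg max_(y > t | y \notin codom e) r k y].
have aNe : a \notin codom e by rewrite /a; case: arg_maxnP.
have a_max y : y \notin codom e -> r k y <= r k a.
  by rewrite /a; case: arg_maxnP => // z _; apply.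
have memAP x : reflect (exists2 j, j != k & x = e j) (x \in e @: [set~ k]).
  apply: (iffP imsetP) => [[j]|[j jk ->]]; rewrite ?inE; first by exists j.
  by exists j; rewrite ?inE.
have slackNle i v : v \notin codom e -> ~~ (r i v <= r i (e i)).
  move=> vNe; apply: contra vNe => vi.
  have -> : v = e i by apply: (@r_inj i); apply/eqP; rewrite eqn_leq vi r_slack_min.
  exact: codom_f.
have memA j : j != k -> e j \in e @: [set~ k] by move=> jk; apply/memAP; exists j.
suff -> : [set x | (x \notin e @: [set~ k]) && dominant (x |: e @: [set~ k])] =
  [set a] by rewrite cards1.
apply/setP => x; rewrite in_set in_set1; apply/andP/eqP => [[xNA domx]|->].
  have xNe : x \notin codom e.
    apply/negP => /codomP[j xj]; rewrite xj in xNA domx.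
    have [i it] := dominantP _ domx t.
    have := slackNle i t tNe; rewrite it// !inE.
    have [->|ik] := eqVneq i k; last by rewrite memA ?orbT.
    have [->|jk] := eqVneq j k; first by rewrite eqxx.
    by rewrite memA// in xNA.
  have [i ia] := dominantP _ domx a.
  have ik : i = k.
    apply/eqP/negPn/negP => ik; have := slackNle i a aNe.
    by rewrite ia// setU1r// memA.
  apply: (@r_inj k); apply/eqP; rewrite eqn_leq a_max//= -{1 2}ik ia//.
  exact: setU11.
split; first by apply/memAP => -[j _ aj]; rewrite aj codom_f in aNe.
apply/dominantP => v; have [/codomP[i ->]|vNe] := boolP (v \in codom e).
  by exists i => y _.
exists k => y /setU1P[->|/memAP[j jk ->]]; first exact: a_max.
by apply/ltnW/r_slack_max.
Qed.

(** If removing [x] leaves exactly the colours other than [k], counting makes [c] injective on the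
    rest. As [S] is not rainbow, [c x] is repeated at a single [y], and removing [y] is the only
    other way to get a door. *)
Lemma card_doors (S : {set V}) k : #|S| = #|I| -> c @: S != [set: I] ->
  ~~ odd #|[set x in S | c @: (S :\ x) == [set~ k]]|.
Proof.
move=> cardS cS.
have [->|] := eqVneq [set x in S | c @: (S :\ x) == [set~ k]] set0.
  by rewrite cards0.
have cardSD x : x \in S -> #|S :\ x| = #|[set~ k]|.
  by move=> xS; have := cardsC1 k; have := cardsD1 x S; rewrite xS; lia.
have c_inj x : x \in S -> c @: (S :\ x) = [set~ k] -> {in S :\ x &, injective c}.
  by move=> xS cx; apply/imset_injP; rewrite cx cardSD.
case/set0Pn => x; rewrite inE => /andP[xS /eqP cx].
have cxk : c x != k.
  apply: contra cS => /eqP cxk; rewrite -(setD1K xS) imsetU1 cx cxk.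
  by apply/eqP/setP => y; rewrite !inE orbN.
have : c x \in c @: (S :\ x) by rewrite cx !inE.
case/imsetP => y; rewrite !inE => /andP[yx yS] cxy.
have cy : c @: (S :\ y) = [set~ k].
  rewrite -cx -(setD1K (_ : x \in S :\ y)); last by rewrite !inE eq_sym yx.
  rewrite -[in RHS](setD1K (_ : y \in S :\ x)); last by rewrite !inE yx.
  by rewrite !imsetU1 cxy !setDDl (setUC [set y]).
suff -> : [set x in S | c @: (S :\ x) == [set~ k]] = [set x; y].
  by rewrite cards2 eq_sym yx.
apply/setP => z; rewrite inE in_set2; apply/andP/orP => [[zS /eqP cz]|].
  have [|zx] := eqVneq z x; first by left.
  right; apply/negPn/negP => zy.
  have := c_inj _ zS cz x y; rewrite !inE xS yS ![_ == z]eq_sym zx zy.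
  by move=> /(_ isT isT cxy)/eqP; rewrite eq_sym (negPf yx).
by move=> [/eqP->|/eqP->]; split => //; apply/eqP.
Qed.

(* Count the pairs (S, x) with S a room and x in S such that S minus x has all
   colours but k: the doors of a room come in pairs unless it is rainbow, and
   the rooms at a door come in pairs except at the all-slack one. *)
Lemma exists_rainbow_room (t : V) : t \notin codom e -> 0 < #|I| ->
  exists2 S : {set V}, dominant S & c @: S = [set: I].
Proof.
move=> tNe /card_gt0P[k _].
pose room (S : {set V}) := dominant S && (#|S| == #|I|).
suff /existsP[S /andP[/andP[domS _] /eqP cS]] :
  [exists S, room S && (c @: S == [set: I])] by exists S.
apply: contraT => /existsPn Nrainbow.
pose door (A : {set V}) := (#|A|.+1 == #|I|) && (c @: A == [set~ k]).
have : ~~ odd (\sum_(S | room S) #|[set x in S | c @: (S :\ x) == [set~ k]]|).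
  apply: even_sum => S roomS.
  case/andP: (roomS) => _ /eqP cardS; apply: card_doors => //.
  by have := Nrainbow S; rewrite roomS.
have -> : \sum_(S | room S) #|[set x in S | c @: (S :\ x) == [set~ k]]| =
  \sum_(A | door A) #|[set x | (x \notin A) && dominant (x |: A)]|.
  under eq_bigr do rewrite -sum1dep_card.
  under [RHS]eq_bigr do rewrite -sum1dep_card.
  rewrite (exchange_big_dep predT)//= [RHS](exchange_big_dep predT)//=.
  apply: eq_bigr => x _.
  rewrite (reindex_onto (fun A => x |: A) (fun S => S :\ x)) /=; last first.
    by move=> S /andP[_ /andP[xS _]]; rewrite setD1K.
  apply: eq_bigl => A; rewrite /room /door setU11 /=.
  have [xA|xA] := boolP (x \in A); last first.
    rewrite setU1K// eqxx cardsU1 xA add1n andbT /=.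
    by case: (dominant _); rewrite /= ?andbF ?andbT.
  rewrite /= andbF; apply/negbTE; rewrite !negb_and orbC; apply/orP; left.
  by apply: contraL xA => /eqP <-; rewrite !inE eqxx.
have doorE : door (e @: [set~ k]).
  rewrite /door card_imset//; apply/andP; split.
    by have := cardsC1 k; have : 0 < #|I| by [apply/card_gt0P; exists k]; lia.
  rewrite -imset_comp; apply/eqP/setP => i; apply/imsetP/idP.
    by move=> [j jk /= ->]; rewrite c_slack.
  by move=> ik; exists i; rewrite //= c_slack.
rewrite (bigD1 _ doorE) /= (card_extensions_outer _ tNe) oddD /= negbK.
apply: contraLR => _; apply: even_sum => A /andP[/andP[/eqP cardA /eqP cA] AE].
have [|/subsetPn[s sA sNe]] := boolP (A \subset codom e); last first.
  exact: card_extensions_inner cardA sA sNe.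
(* A slack element is determined by its colour, so a door made of slack elements can only be the
   exceptional one. *)
move=> /subsetP Ae; case/negP: AE; rewrite eqEcard card_imset//.
apply/andP; split; last by have := cardsC1 k; lia.
apply/subsetP => x xA; have /codomP[j xj] := Ae _ xA.
by rewrite xj imset_f// -cA -[j]c_slack -xj imset_f.
Qed.

End Rooms.

(** * Scarf's lemma for integer weights and on a grid of the simplex *)

(** The points of [T] and one slack element per order feed [exists_rainbow_room]; [S] is the
    non-slack part of the room. For a given [t], dominance holds in some order [i]; an element of
    colour [i] in the room cannot be the slack one, which is lowest for [i], so it is the wanted
    [z]. *)
Lemma scarf (T : finType) n (w : 'I_n.+1 -> T -> nat) (c : T -> 'I_n.+1) (t0 : T) :
  exists S : {set T}, forall t,
    exists2 z, z \in S & forall x, x \in S -> w (c z) t <= w (c z) x.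
Proof.
pose m := #|T|; pose B := (\max_(i < n.+1) \max_(t : T) w i t).+1.
pose V := (T + 'I_n.+1)%type.
(* The factor [m] lets the rank break ties in [w] without reversing strict inequalities; the
   successor leaves [0] to slack element [i], and [B * m] puts the other slack elements on top. *)
pose r (i : 'I_n.+1) (v : V) := match v with
  | inl t => (w i t * m + enum_rank t).+1
  | inr j => if j == i then 0 else (B * m + j).+1 end.
pose cV (v : V) := match v with inl t => c t | inr j => j end.
have wB i t : w i t < B.
  by rewrite ltnS (bigmax_sup i)// (bigmax_sup t).
have rank_lt (t : T) : enum_rank t < m by exact: ltn_ord.
have wr i t : r i (inl t) <= B * m.
  rewrite /r; have := wB i t; have := rank_lt t; nia.
have r_inj i : injective (r i).
  move=> [s|j] [t|l].
  - rewrite /r => -[st].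
    have : enum_rank s = enum_rank t :> nat.
      have : (w i s * m + enum_rank s) %% m = (w i t * m + enum_rank t) %% m.
        by rewrite st.
      by rewrite !modnMDl !modn_small.
    by move=> /ord_inj/enum_rank_inj ->.
  - by have := wr i s; rewrite /r; case: ifP; lia.
  - by have := wr i t; rewrite /r; case: ifP; lia.
  - rewrite /r; case: eqP => [->|_]; case: eqP => [->|_]//.
    by move=> [/addnI/ord_inj ->].
have [||||S /dominantP domS cS] :=
  @exists_rainbow_room _ V r inr cV r_inj _ _ (fun=> erefl) (inl t0).
- by move=> i [t|j]; rewrite /r eqxx.
- move=> i j [t _ ji|l /negP[]]; last exact: codom_f.
  by apply: leq_ltn_trans (wr i t) _; rewrite /r (negPf ji) ltnS leq_addr.
- by apply/negP => /codomP[].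
- by rewrite card_ord.
exists [set t | inl t \in S] => t; have [i it] := domS (inl t).
have : i \in cV @: S by rewrite cS inE.
case/imsetP => -[z|j] zS /= iz; last first.
  by have := it _ zS; rewrite /r -iz eqxx.
exists z; first by rewrite inE.
move=> x; rewrite inE => xS; rewrite -iz; have := it _ xS.
rewrite /r; have := rank_lt t; have := rank_lt x; nia.
Qed.

(** In [scarf] with the coordinates as weights, no grid point exceeds all the coordinate minima of
    [S] over the set [C] of colours present. So these minima plus [#|C|] sum to more than [N], and a
    point of [S] exceeds each of them, or [0] at an absent colour, by at most [n.+1]. *)
Lemma scarf_grid n N (c : ('I_n.+1 -> nat) -> 'I_n.+1) :
  exists2 x : 'I_n.+1 -> nat, \sum_i x i = N & forall i,
    x i <= n.+1 \/ exists z : 'I_n.+1 -> nat,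
      [/\ \sum_i z i = N, c z = i &
          forall j, z j <= x j + n.+1 /\ x j <= z j + n.+1].
Proof.
pose total (t : {ffun 'I_n.+1 -> 'I_N.+1}) := \sum_i t i == N :> nat.
pose T := {t | total t}.
pose pt (t : T) : 'I_n.+1 -> nat := fun i => sval t i.
have pt_sum t : \sum_i pt t i = N by exact/eqP/(valP t).
have liftT (f : 'I_n.+1 -> nat) : \sum_i f i = N -> exists t : T, pt t =1 f.
  move=> fN; have fle i : f i < N.+1 by rewrite ltnS -fN (bigD1 i)//= leq_addr.
  have fE : total [ffun i => Ordinal (fle i)].
    by rewrite /total -[X in _ == X]fN; apply/eqP/eq_bigr => i _; rewrite ffunE.
  by exists (exist total _ fE) => i; rewrite /pt /= ffunE.
have [t0 _] : exists t : T, pt t =1 fun i => if i == ord0 then N else 0.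
  by apply: liftT; rewrite -big_mkcond big_pred1_eq.
have [S domS] := @scarf T n (fun i t => pt t i) (fun t => c (pt t)) t0.
have [s sS _] := domS t0.
pose C : {set 'I_n.+1} := [set c (pt t) | t in S].
pose m i := pt [arg min_(t < s in S) pt t i] i.
have m_le i t : t \in S -> m i <= pt t i.
  by rewrite /m; case: arg_minnP => // u _ + tS; apply.
have mS i : exists2 t, t \in S & m i = pt t i.
  by rewrite /m; case: arg_minnP => // u uS _; exists u.
have domC t : exists2 i, i \in C & pt t i <= m i.
  have [z zS zt] := domS t; exists (c (pt z)); first exact: imset_f.
  by have [u uS ->] := mS (c (pt z)); exact: zt.
(* Otherwise some grid point has coordinate at least [m i + 1] for each [i] in [C], the remainder
   being added at [k]; it violates [domC]. *)
have sum_m : N < \sum_(i in C) (m i).+1.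
  rewrite ltnNge; apply/negP => mN.
  pose k := c (pt s); have kC : k \in C by exact: imset_f.
  pose f i := (if i \in C then (m i).+1 else 0) +
              (if i == k then N - \sum_(i in C) (m i).+1 else 0).
  have [|t tf] := liftT f.
    by rewrite /f big_split/= -!big_mkcond/= big_pred1_eq subnKC.
  have [i iC] := domC t; rewrite tf /f iC; lia.
have sumC : \sum_(i in C) (m i).+1 = \sum_(i in C) m i + #|C|.
  by rewrite -sum1_card -big_split/=; apply: eq_bigr => i _; rewrite addn1.
have cardC : #|C| <= n.+1 by rewrite -[X in _ <= X]card_ord max_card.
have arith a b d k l q : k <= n.+1 -> b <= d ->
    a + d + q < l + b + k -> a <= l + n.+1 by lia.
have boundC t i : t \in S -> i \in C -> pt t i <= m i + n.+1.
  move=> tS iC; have := pt_sum t.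
  rewrite (bigID (mem C))/= (bigD1 i)//= => tN.
  have := sum_m; rewrite sumC (bigD1 i)//=.
  have : \sum_(j in C | j != i) m j <= \sum_(j in C | j != i) pt t j.
    by apply: leq_sum => j _; exact: m_le.
  by move: tN cardC => <-; exact: arith.
have boundNC t i : t \in S -> i \notin C -> pt t i <= n.+1.
  move=> tS iNC; have := pt_sum t.
  rewrite (bigID (mem C))/= [X in _ + X](bigD1 i)//= => tN.
  have := sum_m; rewrite sumC.
  have : \sum_(j in C) m j <= \sum_(j in C) pt t j.
    by apply: leq_sum => j _; exact: m_le.
  by move: tN cardC => <-; rewrite addnCA addnA; exact: (@arith _ _ _ _ 0).
exists (pt s) => // i.
have [/imsetP[z zS iz]|iNC] := boolP (i \in C); last by left; exact: boundNC.
right; exists (pt z); split => // j.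
have [jC|jNC] := boolP (j \in C).
  have := boundC _ _ zS jC; have := boundC _ _ sS jC.
  by have := m_le j _ zS; have := m_le j _ sS; lia.
by have := boundNC _ _ zS jNC; have := boundNC _ _ sS jNC; lia.
Qed.

From mathcomp Require Import all_order all_algebra.
From mathcomp Require Import all_classical all_reals all_analysis.
From mathcomp Require Import ring lra.
Import Order.TTheory GRing.Theory Num.Theory.
Import numFieldNormedType.Exports.
Local Open Scope classical_set_scope.
Local Open Scope ring_scope.

(** * The KKM theorem *)

Lemma sum_continuous (R : realType) (T : topologicalType) (I : Type) (s : seq I)
    (f : I -> T -> R) :
  (forall i, continuous (f i)) -> continuous (fun x => \sum_(i <- s) f i x).
Proof.
move=> fc; elim: s => [|i s IHs] x.
  by under eq_fun do rewrite big_nil; exact: cvg_cst.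
under eq_fun do rewrite big_cons.
by apply: cvgD; [exact: fc|exact: IHs].
Qed.

Lemma sub_mul_continuous (R : realType) (T : topologicalType) (f g h : T -> R) :
  continuous f -> continuous g -> continuous h ->
  continuous (fun x => f x - g x * h x).
Proof.
move=> fc gc hc x; apply: cvgB; first exact: fc.
by apply: cvgM; [exact: gc|exact: hc].
Qed.

Section Simplex.
Context {R : realType}.

Definition simplex n : set 'rV[R]_n :=
  [set x | (forall i, 0 <= x ord0 i) /\ \sum_i x ord0 i = 1].
Arguments simplex : clear implicits.

Lemma mx_norm_le n (x : 'rV[R]_n) (M : R) :
  0 <= M -> (forall i, `|x ord0 i| <= M) -> `|x| <= M.
Proof.
move=> M0 xM; rewrite [leLHS]/Num.norm/= mx_normrE.
by apply/bigmax_leP; split => // -[i j] _ /=; rewrite ord1.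
Qed.

Lemma mx_norm_coord n (x : 'rV[R]_n) i : `|x ord0 i| <= `|x|.
Proof.
by rewrite [leRHS]/Num.norm/= mx_normrE; apply/bigmax_geP; right; exists (ord0, i).
Qed.

Lemma compact_simplex n : compact (simplex n).
Proof.
apply: bounded_closed_compact.
  exists 1; split => // M M1 x [x0 x1]; apply: mx_norm_le => [|i]; first lra.
  rewrite ger0_norm//; apply: le_trans (ltW M1); rewrite -x1 (bigD1 i)//=.
  by rewrite lerDl sumr_ge0.
have -> : simplex n = (\bigcap_i [set x : 'rV[R]_n | 0 <= x ord0 i]) `&`
    [set x : 'rV[R]_n | \sum_i x ord0 i = 1].
  apply/seteqP; split=> x /= [x0 x1]; split=> // i; first by move=> _; exact: x0.
  exact: x0.
apply: closedI.
  apply: closed_bigI => i _.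
  apply: (@closed_comp _ _ (fun x : 'rV[R]_n => x ord0 i) [set y | 0 <= y]).
    by move=> x _; exact: coord_continuous.
  exact: closed_ge.
apply: (@closed_comp _ _ (fun x : 'rV[R]_n => \sum_i x ord0 i) [set y | y = 1]).
  by move=> x _; apply: sum_continuous => i; exact: coord_continuous.
exact: closed_eq.
Qed.

(** Each grid point of mesh [1 / k.+1] is coloured by an index [i] with [H i] containing it.
    [scarf_grid] then gives a point that, for each [i], is within [O(1/k)] of [H i] or has an [i]-th
    coordinate of that size. A cluster point of these is in every [H i], by closedness or by the
    boundary condition. *)
Lemma closed_cover_simplex n (H : 'I_n.+1 -> set 'rV[R]_n.+1) :
  (forall i, closed (H i)) ->
  (forall x, simplex _ x -> exists i, H i x) ->
  (forall x i, simplex _ x -> x ord0 i = 0 -> H i x) ->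
  exists2 x, simplex _ x & forall i, H i x.
Proof.
move=> clH covH bdH.
have approx k : exists2 x : 'rV[R]_n.+1, simplex _ x & forall i,
    x ord0 i <= n.+1%:R / k.+1%:R \/
    exists2 z, H i z & `|x - z| <= n.+1%:R / k.+1%:R.
  pose pt (z : 'I_n.+1 -> nat) : 'rV[R]_n.+1 := \row_i ((z i)%:R / k.+1%:R).
  have ptS z : (\sum_i z i)%N = k.+1 -> simplex _ (pt z).
    move=> zk; split=> [i|]; first by rewrite mxE divr_ge0.
    under eq_bigr do rewrite mxE.
    by rewrite -mulr_suml -natr_sum zk divff.
  have [x xk xP] := @scarf_grid n k.+1 (fun z => xget ord0 [set i | H i (pt z)]).
  exists (pt x); first exact: ptS.
  move=> i; have [xi|[z [zk zi xz]]] := xP i; [left|right].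
    by rewrite mxE ler_pM2r ?ler_nat// invr_gt0.
  exists (pt z).
    by rewrite -zi; apply: (@xgetPex _ ord0 [set i | H i (pt z)]); exact: covH (ptS _ zk).
  apply: mx_norm_le => [|j]; first by rewrite divr_ge0.
  rewrite !mxE -mulrBl normrM [X in _ * X]gtr0_norm ?invr_gt0//.
  rewrite ler_pM2r ?invr_gt0// ler_distl -[X in X <= _ <= _]opprK.
  have [zx xz'] := xz j; move: zx xz'.
  by rewrite -!(ler_nat R) !natrD => zx xz'; lra.
have [u uS uP] : exists2 u : nat -> 'rV[R]_n.+1, (forall k, simplex _ (u k)) &
    forall k i, u k ord0 i <= n.+1%:R / k.+1%:R \/
      exists2 z, H i z & `|u k - z| <= n.+1%:R / k.+1%:R.
  pose u k := projT1 (cid2 (approx k)).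
  by exists u => k; rewrite /u; case: cid2.
have [x [xS xu]] : simplex n.+1 `&` cluster (u @ \oo) !=set0.
  by apply: (@compact_simplex n.+1) => /=; near=> k; exact: uS.
exists x => // i; apply: contrapT => NHx.
have xi_gt0 : 0 < x ord0 i.
  by rewrite lt_neqAle xS.1 andbT eq_sym; apply/eqP => /bdH - /(_ xS).
have : nbhs x (~` H i) by apply: open_nbhs_nbhs; split => //; exact/closed_openC.
rewrite -nbhs_ballE => -[eps /= eps0 epsH].
(* Half of [eps] serves each leg of the triangle inequality; half of the coordinate keeps [u k] from
   having a small [i]-th coordinate. *)
pose del := Num.min (eps / 2) (x ord0 i / 2).
have del0 : 0 < del by rewrite lt_min !divr_gt0.
have del_le : del <= eps / 2 /\ del <= x ord0 i / 2.
  by split; rewrite /del ge_min lexx ?orbT.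
have small : \forall k \near \oo, n.+1%:R / k.+1%:R < del :> R.
  have deln : 0 < del / n.+1%:R by rewrite divr_gt0.
  near=> k; rewrite mulrC -ltr_pdivlMr//.
  by near: k; exact: (near_infty_natSinv_lt (PosNum deln)).
have [_ [[k kdel <-] ukx]] :
    (u @` [set k | n.+1%:R / k.+1%:R < del] `&` ball x del) !=set0.
  apply: xu; last exact: nbhsx_ballx.
  by apply: filterS small => k kdel; exists k.
have {}ukx : `|x - u k| < del by rewrite mx_norm_ball in ukx.
have [uki|[z Hz ukz]] := uP k i.
  have := le_lt_trans (mx_norm_coord (x - u k) i) ukx.
  rewrite !mxE ltr_norml => /andP[_]; move: del_le.2 (le_lt_trans uki kdel); lra.
apply: epsH Hz; rewrite mx_norm_ball /=.
rewrite -[x](subrK (u k)) -addrA (le_lt_trans (ler_normD _ _))//.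
move: del_le.1 (le_lt_trans ukz kdel) ukx; lra.
Unshelve. all: by end_near. Qed.

End Simplex.

Arguments simplex {R} n _.

Section SetDistance.
Context {R : realType} {X : normedModType R} (A : set X).
Hypothesis A0 : A !=set0.

Definition set_dist (x : X) : R := inf [set `|x - a| | a in A].

Let has_inf_dist x : has_inf [set `|x - a| | a in A].
Proof.
split; first by case: A0 => a Aa; exists `|x - a|, a.
by exists 0 => _ [a _ <-].
Qed.

Lemma set_dist_ge0 x : 0 <= set_dist x.
Proof. by apply: lb_le_inf; [case: (has_inf_dist x)|move=> _ [a _ <-]]. Qed.

Lemma set_dist_le x a : A a -> set_dist x <= `|x - a|.
Proof. by move=> Aa; apply: ge_inf; [case: (has_inf_dist x)|exists a]. Qed.

Lemma set_dist_mem x : A x -> set_dist x = 0.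
Proof.
by move=> /(set_dist_le x); rewrite subrr normr0 => ?; apply/le_anti;
  rewrite set_dist_ge0 andbT.
Qed.

Lemma set_dist_lt x (e : R) : set_dist x < e -> exists2 a, A a & `|x - a| < e.
Proof.
by move=> /(inf_lt (has_inf_dist x).1)[_ [a Aa <-]]; exists a.
Qed.

Lemma set_dist_lipschitz x y : set_dist x <= `|x - y| + set_dist y.
Proof.
rewrite -lerBlDl; apply: lb_le_inf; first by case: (has_inf_dist y).
move=> _ [a Aa <-]; rewrite lerBlDl; apply: le_trans (set_dist_le x Aa) _.
by rewrite -[x - a](subrKA y) ler_normD.
Qed.

Lemma set_dist_continuous : continuous set_dist.
Proof.
move=> x; apply/cvgrPdist_le => e e0; near=> y.
have xye : `|x - y| <= e.
  by near: y; move: e e0; apply/cvgrPdist_le; exact: cvg_id.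
rewrite ler_distl; apply/andP; split.
  by have := set_dist_lipschitz y x; rewrite distrC; lra.
by have := set_dist_lipschitz x y; lra.
Unshelve. all: by end_near. Qed.

Lemma set_dist_closed x : closed A -> set_dist x = 0 -> A x.
Proof.
move=> clA x0; apply: clA => B /nbhs_ballP[e /= e0 eB].
have [|a Aa xa] := @set_dist_lt x e; first by rewrite x0.
by exists a; split => //; apply: eB; rewrite -ball_normE.
Qed.

End SetDistance.

(** The second hypothesis is the KKM covering of each face by the sets of its vertices. A point with
    [x i * S x <= d i x] for all [i] lies in some [G i] with [x i > 0]; hence [S x <= 0] and all the
    distances vanish. *)
Lemma kkm (R : realType) n (G : 'I_n.+1 -> set 'rV[R]_n.+1) :
  (forall i, closed (G i)) ->
  (forall x, simplex _ x -> exists2 i, 0 < x ord0 i & G i x) ->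
  exists2 x, simplex _ x & forall i, G i x.
Proof.
move=> clG covG.
have G0 i : G i !=set0.
  have [|j] := covG (delta_mx ord0 i).
    split=> [j|]; first by rewrite mxE ler0n.
    under eq_bigr do rewrite mxE eqxx.
    by rewrite (bigD1 i)//= eqxx big1 ?addr0// => j /negPf ->.
  rewrite mxE eqxx/=; case: eqP => [-> _ Gi|_]; last by rewrite ltxx.
  by exists (delta_mx ord0 i).
pose d i := set_dist (G i); pose S x := \sum_i d i x.
have d_ge0 i x : 0 <= d i x by exact: set_dist_ge0.
have gc i : continuous (fun x : 'rV[R]_n.+1 => d i x - x ord0 i * S x).
  apply: sub_mul_continuous; first by apply: set_dist_continuous; exact: G0.
    exact: coord_continuous.
  by apply: sum_continuous => j; apply: set_dist_continuous; exact: G0.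
(* This cover encodes the fixed points of x |-> d x / S x. *)
have [|x xS|x i xS xi0|x xS xH] :=
  @closed_cover_simplex R n (fun i => [set x : 'rV[R]_n.+1 | 0 <= d i x - x ord0 i * S x]).
- by move=> i; apply: preimage_closed (@closed_ge R 0) => x _; exact: gc.
- apply: contrapT => /forallNP xH.
  have : \sum_i d i x < \sum_i x ord0 i * S x.
    apply: ltr_sum => [|i _]; first by rewrite /index_enum; apply/hasP; exists ord0.
    by rewrite ltNge -subr_ge0; apply/negP; exact: xH.
  by rewrite -mulr_suml xS.2 mul1r ltxx.
- by rewrite /= xi0 mul0r subr0.
exists x => // j; apply: set_dist_closed => //.
have [i xi Gx] := covG x xS.
have := xH i; rewrite /= subr_ge0 [d i x]set_dist_mem// pmulr_rle0// => S0.
apply/le_anti; rewrite set_dist_ge0// andbT; apply: le_trans S0.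
by rewrite /S (bigD1 j)//= lerDl sumr_ge0.
Qed.

(** * Separation of a point from a closed convex set *)

Section Sublinear.
Context {R : realType} {X : lmodType R}.
Implicit Types p q : X -> R.

(** The inequality for [t > 0] passes to infima directly, and scaling back by the inverse turns it
    into an equality. *)
Definition sublinear p :=
  (forall x y, p (x + y) <= p x + p y) /\
  (forall (t : R) x, 0 < t -> p (t *: x) <= t * p x).

Lemma sublinearZ p t x : sublinear p -> 0 < t -> p (t *: x) = t * p x.
Proof.
move=> [_ pZ] t0; apply/le_anti; rewrite pZ//=.
rewrite -ler_pdivlMl// -[x in leLHS](scalerK (lt0r_neq0 t0)).
by apply: pZ; rewrite invr_gt0.
Qed.

Lemma sublinear0 p : sublinear p -> p 0 = 0.
Proof.
move=> ps; have : 0 < 2 :> R by [].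
by move=> /(sublinearZ 0 ps); rewrite scaler0; lra.
Qed.

Lemma sublinearN p x : sublinear p -> - p (- x) <= p x.
Proof.
by move=> ps; have := ps.1 x (- x); rewrite subrr sublinear0//; lra.
Qed.

(* The family q(x + t a) - t q(a), t >= 0, has a sublinear infimum below q, so
   minimality of q forces q(x) + q(a) <= q(x + a). *)
Lemma minimal_sublinear_linear q : sublinear q ->
  (forall p, sublinear p -> (forall x, p x <= q x) -> p = q) ->
  linear (q : X -> R^o).
Proof.
move=> qs qmin.
have q_le0 t x : 0 <= t -> q (t *: x) = t * q x.
  by rewrite le_eqVlt => /predU1P[<-|/(sublinearZ x qs)//];
    rewrite scale0r mul0r sublinear0.
have supadd x a : q x + q a <= q (x + a).
  pose E y := [set q (y + t *: a) - t * q a | t in [set t : R | 0 <= t]].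
  pose p y := inf (E y).
  have infE y : has_inf (E y).
    split; first by exists (q (y + 0 *: a) - 0 * q a), 0 => //=.
    exists (- q (- y)) => _ [t /= t0 <-].
    have := qs.1 (- y) (y + t *: a); rewrite addKr q_le0//; lra.
  have p_le y t : 0 <= t -> p y <= q (y + t *: a) - t * q a.
    by move=> t0; apply: ge_inf; [case: (infE y)|exists t].
  have ps : sublinear p.
    split=> [y z|s y s0].
      rewrite -lerBlDr; apply: lb_le_inf => [|_ [t /= t0 <-]].
        by case: (infE y).
      rewrite lerBlDr -lerBlDl; apply: lb_le_inf => [|_ [u /= u0 <-]].
        by case: (infE z).
      rewrite lerBlDl; have := p_le (y + z) (t + u) (addr_ge0 t0 u0).
      have := qs.1 (y + t *: a) (z + u *: a).
      by rewrite addrACA -scalerDl; lra.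
    rewrite -ler_pdivrMl//; apply: lb_le_inf => [|_ [t /= t0 <-]].
      by case: (infE y).
    rewrite ler_pdivrMl//; apply: le_trans (p_le _ (s * t) _) _.
      by rewrite mulr_ge0// ltW.
    by rewrite -scalerA -scalerDr sublinearZ//; lra.
  have qp : q = p.
    apply/esym/qmin => // y; have := p_le y 0 (lexx _).
    by rewrite scale0r mul0r subr0 addr0.
  have := p_le x 1 ler01; rewrite scale1r mul1r -(congr1 (@^~ x) qp) /=; lra.
have qD x y : q (x + y) = q x + q y by apply/le_anti; rewrite qs.1 supadd.
have qN x : q (- x) = - q x.
  by apply/eqP; rewrite -addr_eq0 -qD addNr sublinear0.
move=> a x y; rewrite qD; congr (_ + _).
have [a0|a0] := leP 0 a; first exact: q_le0.
rewrite -[a in LHS]opprK scaleNr qN q_le0; first by rewrite -[RHS]/(a * q x) mulNr opprK.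
by rewrite oppr_ge0 ltW.
Qed.

(** Zorn's lemma for the reversed pointwise order on the sublinear functionals below [p]: a chain
    has its pointwise infimum as bound, finite because of [- p (- x)], and a minimal functional is
    linear. *)
Lemma hahn_banach p : sublinear p ->
  exists2 g : X -> R^o, linear g & forall x, g x <= p x.
Proof.
move=> ps; pose T := {q | sublinear q /\ forall x, q x <= p x}.
pose le_ (s t : T) := `[< forall x, sval t x <= sval s x >].
have T_ge (s : T) x : - p (- x) <= sval s x.
  case: s => s [ss sp] /=; apply: le_trans (sublinearN x ss).
  by rewrite lerN2.
have [|r s t /asboolP rs /asboolP st|s t /asboolP st /asboolP ts|A Atot|] :=
  @Zorn T le_.
- by move=> t; apply/asboolP => x.
- by apply/asboolP => x; exact: le_trans (st x) (rs x).
- case: s t st ts => [s ?] [t ?] /= st ts.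
  by apply: eq_exist; apply/funext => x; apply/le_anti; rewrite st ts.
- have [[s0 As0]|A0] := pselect (A !=set0); last first.
    exists (exist _ p (conj ps (fun x => lexx _))) => s As.
    by case: A0; exists s.
  pose q x := inf [set sval s x | s in A].
  have infA x : has_inf [set sval s x | s in A].
    split; first by exists (sval s0 x), s0.
    by exists (- p (- x)) => _ [s _ <-].
  have q_le s x : A s -> q x <= sval s x.
    by move=> As; apply: ge_inf; [case: (infA x)|exists s].
  have qs : sublinear q.
    split=> [x y|t x t0].
      rewrite -lerBlDr; apply: lb_le_inf => [|_ [s /= As <-]].
        by case: (infA x).
      rewrite lerBlDr -lerBlDl; apply: lb_le_inf => [|_ [t /= At <-]].
        by case: (infA y).
      rewrite lerBlDl; have [/asboolP st|/asboolP ts] := Atot _ _ As At.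
        have [[+ _] _] := proj2_sig t => /(_ x y) txy.
        by have := q_le t (x + y) At; have := st x; lra.
      have [[+ _] _] := proj2_sig s => /(_ x y) sxy.
      by have := q_le s (x + y) As; have := ts y; lra.
    rewrite -ler_pdivrMl//; apply: lb_le_inf => [|_ [s /= As <-]].
      by case: (infA x).
    rewrite ler_pdivrMl//; apply: le_trans (q_le _ _ As) _.
    by have [[_ +] _] := proj2_sig s; apply.
  have qp x : q x <= p x.
    by apply: le_trans (q_le s0 x As0) _; have [_] := proj2_sig s0; apply.
  by exists (exist _ q (conj qs qp)) => s As; apply/asboolP => x; exact: q_le.
move=> [q [qs qp]] qmax; exists q => //.
apply: minimal_sublinear_linear => // r rs rq.
have rp x : r x <= p x by exact: le_trans (rq x) (qp x).
by have [] := qmax (exist _ r (conj rs rp)) (asboolT rq).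
Qed.

End Sublinear.

Section Separation.
Context {R : realType} {X : normedModType R}.

Lemma convex_set_conv (E : lmodType R) (A : set E) (t : R) x y :
  convex_set A -> A x -> A y -> 0 <= t <= 1 -> A (t *: x + (1 - t) *: y).
Proof.
move=> cvxA Ax Ay /andP[t0 t1].
by have /set_mem := cvxA x y (Itv01 t0 t1) (mem_set Ax) (mem_set Ay).
Qed.

Lemma bounded_linear_functional_continuous (g : X -> R^o) (M : R) :
  linear g -> (forall x, g x <= M * `|x|) -> continuous g.
Proof.
move=> glin gM.
have gB x y : g (x - y) = g x - g y.
  by rewrite addrC -scaleN1r glin scaleN1r addrC.
have gBM x y : `|g x - g y| <= M * `|x - y|.
  by rewrite ler_norml lerNl opprB -!gB [in X in X && _]distrC !gM.
move=> x; apply/cvgrPdist_le => e e0.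
have M1 : 0 < `|M| + 1 by rewrite ltr_wpDl.
have eM : 0 < e / (`|M| + 1) by rewrite divr_gt0.
near=> y; apply: le_trans (gBM x y) _.
have xy : `|x - y| <= e / (`|M| + 1).
  by near: y; move: eM; move: (e / _); apply/cvgrPdist_le; exact: cvg_id.
apply: le_trans (_ : (`|M| + 1) * `|x - y| <= _); last by rewrite mulrC -ler_pdivlMr.
by rewrite ler_wpM2r// (le_trans (ler_norm _))// lerDl.
Unshelve. all: by end_near. Qed.

(* [q] is the infimum of |x - t (a - x0)| - t delta over a in A and t >= 0;
   convexity of A makes it subadditive. *)
Lemma closed_convex_separation (A : set X) (x0 : X) :
  convex_set A -> closed A -> A !=set0 -> ~ A x0 ->
  exists2 g : X -> R^o, linear g /\ continuous g &
    exists2 d : R, 0 < d & forall a, A a -> g a <= g x0 - d.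
Proof.
move=> cvxA clA [a0 Aa0] NAx0.
have : nbhs x0 (~` A) by apply: open_nbhs_nbhs; split => //; exact/closed_openC.
move=> /nbhs_ballP[d /= d0 dA]; have {}dA a : A a -> d <= `|a - x0|.
  move=> Aa; rewrite leNgt; apply/negP => ax0; apply: (dA a) Aa.
  by rewrite -ball_normE /= distrC.
pose E x := [set `|x - ta.1 *: (ta.2 - x0)| - ta.1 * d |
  ta in [set ta : R * X | 0 <= ta.1 /\ A ta.2]].
pose q x := inf (E x).
have infE x : has_inf (E x).
  split; first by exists (`|x - 0 *: (a0 - x0)| - 0 * d), (0, a0).
  exists (- `|x|) => _ [[t a] /= [t0 Aa] <-].
  (* [A] stays at distance [d] from [x0], so [t * d] is at most the norm of [t *: (a - x0)]. *)
  have := ler_normB x (x - t *: (a - x0)).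
  rewrite opprB addrC subrK normrZ ger0_norm//.
  have := ler_wpM2l t0 (dA a Aa); lra.
have q_le x t a : 0 <= t -> A a -> q x <= `|x - t *: (a - x0)| - t * d.
  by move=> t0 Aa; apply: ge_inf; [case: (infE x)|exists (t, a)].
have qs : sublinear q.
  split=> [x y|s x s0].
    rewrite -lerBlDr; apply: lb_le_inf => [|_ [[t a] /= [t0 Aa] <-]].
      by case: (infE x).
    rewrite lerBlDr -lerBlDl; apply: lb_le_inf => [|_ [[u b] /= [u0 Ab] <-]].
      by case: (infE y).
    rewrite lerBlDl.
    have [tu0|tu0] := eqVneq (t + u) 0.
      have [-> ->] : t = 0 /\ u = 0 by lra.
      have := q_le (x + y) 0 a (lexx _) Aa; rewrite !scale0r !subr0.
      by have := ler_normD x y; lra.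
    (* [c] is the point of [A] for which [(t + u) *: (c - x0)] is the sum of [t *: (a - x0)] and
       [u *: (b - x0)]. *)
    pose c := (t / (t + u)) *: a + (u / (t + u)) *: b.
    have Ac : A c.
      rewrite /c; have -> : u / (t + u) = 1 - t / (t + u).
        by rewrite -[X in X - _](divff tu0) -mulrBl [t + u]addrC addrK.
      apply: convex_set_conv => //; apply/andP; split.
        by rewrite divr_ge0// addr_ge0.
      by rewrite ler_pdivrMr ?mul1r ?lerDl// lt_neqAle eq_sym tu0 addr_ge0.
    have := q_le (x + y) (t + u) c (addr_ge0 t0 u0) Ac.
    have -> : x + y - (t + u) *: (c - x0) =
        x - t *: (a - x0) + (y - u *: (b - x0)).
      rewrite scalerBr /c scalerDr !scalerA ![(t + u) * _]mulrC !divfK//.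
      rewrite !scalerBr scalerDl addrACA -opprD; congr (_ - _).
      by rewrite opprD addrACA.
    by move: (ler_normD (x - t *: (a - x0)) (y - u *: (b - x0))); lra.
  rewrite -ler_pdivrMl//; apply: lb_le_inf => [|_ [[t a] /= [t0 Aa] <-]].
    by case: (infE x).
  rewrite ler_pdivrMl//; apply: le_trans (q_le _ (s * t) a _ Aa) _.
    by rewrite mulr_ge0// ltW.
  by rewrite -scalerA -scalerBr normrZ gtr0_norm//; lra.
have [g glin gq] := hahn_banach qs.
have q_norm x : q x <= `|x|.
  by have := q_le x 0 a0 (lexx _) Aa0; rewrite scale0r mul0r !subr0.
have gB x y : g (x - y) = g x - g y.
  by rewrite addrC -scaleN1r glin scaleN1r addrC.
exists g; first split => //.
  apply: (@bounded_linear_functional_continuous _ 1) => // x.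
  by rewrite mul1r; apply: le_trans (gq x) (q_norm x).
(* At the vector [a - x0] with [t = 1] the norm in [q] vanishes, which leaves
   [g (a - x0) <= - d]. *)
exists d => // a Aa; have := le_trans (gq (a - x0)) (q_le (a - x0) 1 a ler01 Aa).
by rewrite scale1r subrr normr0 gB mul1r; lra.
Qed.
End Separation.

(** * The weak topology *)

Definition dual_of (R : realType) (X : normedModType R) (g : X -> R^o)
  (gP : linear g /\ continuous g) : dual X := Dual (introT (dual_predP g) gP).

Section WeakTopology.
Context {R : realType} {X : normedModType R}.

Lemma cvg_to_weak (F : set_system (weak X)) (x : weak X) : Filter F ->
  (forall l : dual X, l y @[y --> F] --> (l x : R^o)) -> F --> x.
Proof.
move=> FF Fl A; rewrite nbhsE => -[_ [[B opB <-] Bx] BA].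
apply: filterS BA _.
pose ev := (fun x : X => (fun l => l x) : {ptws dual X -> R^o}).
have : ev @ F --> (ev x : {ptws dual X -> R^o}).
  by apply/pointwise_cvgP.
apply; apply: open_nbhs_nbhs; split => //.
Qed.

Lemma dual_le (l : dual X) (x : X) : `|l x| <= `|l| * `|x|.
Proof.
have [->|x0] := eqVneq x 0; first by rewrite linear0 !normr0 mulr0.
have nx0 : 0 < `|x| by rewrite normr_gt0.
rewrite -ler_pdivrMr// mulrC -[X in X * _]ger0_norm ?invr_ge0// -normrM.
rewrite -[X in `|X|]/(_ *: l x) -linearZ dual_norm_ub//.
by rewrite normrZ normfV normr_id mulVf ?lt0r_neq0.
Qed.

Lemma dual_weak_continuous (l : dual X) :
  continuous (l : weak X -> R^o).
Proof.
move=> x.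
pose ev := (fun x : X => (fun l => l x) : {ptws dual X -> R^o}).
apply: (@continuous_comp _ _ _ (ev : weak X -> _) (fun h => h l)).
  exact: initial_continuous.
exact: proj_continuous.
Qed.

(** Along an ultrafilter on [A] each functional [l] has a limit in a bounded segment. These limits
    form a bounded linear functional of [l], which by reflexivity is evaluation at some [x], the
    weak limit. A functional separating [x] from [A] would contradict this convergence. *)
Lemma convex_bounded_weak_compact (A : set X) (M : R) :
  reflexive_space X -> convex_set A -> closed A -> (forall a, A a -> `|a| <= M) ->
  compact (A : set (weak X)).
Proof.
move=> reflX cvxA clA AM; rewrite compact_ultra => F FU FA.
have [a Aa] : A !=set0 by apply: (@filter_ex _ F).
have M0 : 0 <= M by apply: le_trans (AM a Aa).
have l_cvg (l : dual X) : exists2 y : R, `|y| <= `|l| * M & l @ F --> (y : R^o).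
  have [|y [yM ly]] := @segment_compact R (- (`|l| * M)) (`|l| * M) (l @ F) _.
    apply: (@filterS _ F _ A _ _ FA) => x /AM xM; rewrite /= in_itv/= -ler_norml.
    exact: (le_trans (dual_le l x) (ler_wpM2l (normr_ge0 l) xM)).
  exists y; first by move: yM; rewrite /= in_itv/= -ler_norml.
  (* An ultrafilter converges to any of its cluster points. *)
  move=> B yB; have [//|FNB] := in_ultra_setVsetC (l @^-1` B) FU.
  by have [z []] := ly (~` B) B FNB yB.
pose phi (l : dual X) : R^o := projT1 (cid2 (l_cvg l)).
have phiM l : `|phi l| <= `|l| * M by rewrite /phi; case: cid2.
have Fphi (l : dual X) : l @ F --> phi l by rewrite /phi; case: cid2.
have phi_lin : linear phi.
  move=> c l m.
  apply: (@norm_cvg_unique R R^o ((c *: l + m : dual X) @ F) _ _ _ (Fphi _)).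
  apply: (@cvgD _ _ _ _ _ (fun x => c *: l x : R^o)); last exact: Fphi.
  by apply: cvgZl_tmp; exact: Fphi.
have phi_cts : continuous phi.
  apply: (@bounded_linear_functional_continuous _ _ _ M) => // l.
  by rewrite mulrC; apply: le_trans (ler_norm _) (phiM l).
have [x phix] := reflX (dual_of (conj phi_lin phi_cts)).
exists x.
have Fx (l : dual X) : l @ F --> (l x : R^o) by rewrite -phix; exact: Fphi.
split; last exact: cvg_to_weak.
 apply: contrapT => NAx.
have [g gP [d d0 gA]] := closed_convex_separation cvxA clA (ex_intro _ a Aa) NAx.
have := Fx (dual_of gP).
move=> /cvgr_gt/(_ (g x - d)); rewrite /= ltrBlDr ltrDl => /(_ d0) Fg.
have [b [Ab /=]] := filter_ex (filterI FA Fg).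
by rewrite ltNge gA.
Qed.
End WeakTopology.

(** * Convex combinations in the weak topology *)

(** Only the points of positive weight are known to be in [A], so a zero last weight and a zero sum
    of the other weights are treated apart. *)
Lemma convex_set_sum (R : realType) (E : lmodType R) (A : set E) n
    (lam : 'I_n -> R) (y : 'I_n -> E) :
  convex_set A -> (forall i, 0 <= lam i) -> \sum_i lam i = 1 ->
  (forall i, 0 < lam i -> A (y i)) -> A (\sum_i lam i *: y i).
Proof.
move=> cvxA; elim: n lam y => [|n IHn] lam y lam0 lam1 Ay.
  by move: lam1; rewrite big_ord0 => /esym/eqP; rewrite oner_eq0.
move: lam1; rewrite !big_ord_recr/=; set s := \sum_(i < n) _ => s1.
have [s0|s0] := eqVneq s 0.
  have lam_eq0 i : lam (widen_ord (leqnSn n) i) = 0.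
    by apply/eqP; have /eqP := s0; rewrite psumr_eq0 => [/allP/(_ i)/=|];
      [rewrite mem_index_enum => /(_ isT)|move=> j _; exact: lam0].
  have lam1 : lam ord_max = 1 by rewrite -s1 s0 add0r.
  rewrite lam1 scale1r big1 ?add0r => [|i _]; last by rewrite lam_eq0 scale0r.
  by apply: Ay; rewrite lam1.
have s_gt0 : 0 < s by rewrite lt_neqAle eq_sym s0 sumr_ge0.
have -> : \sum_(i < n) lam (widen_ord (leqnSn n) i) *: y (widen_ord (leqnSn n) i) =
    s *: \sum_(i < n) (s^-1 * lam (widen_ord (leqnSn n) i)) *:
      y (widen_ord (leqnSn n) i).
  by rewrite scaler_sumr; apply: eq_bigr => i _; rewrite scalerA mulrA divff// mul1r.
have As : A (\sum_(i < n) (s^-1 * lam (widen_ord (leqnSn n) i)) *: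
    y (widen_ord (leqnSn n) i)).
  apply: IHn => [i||i]; first by rewrite mulr_ge0// invr_ge0 ltW.
    by rewrite -mulr_sumr mulVf.
  by rewrite pmulr_rgt0 ?invr_gt0//; exact: Ay.
have [lam_n|lam_n] := eqVneq (lam ord_max) 0.
  by move: s1 As; rewrite lam_n addr0 scale0r addr0 => -> As; rewrite scale1r.
have -> : lam ord_max = 1 - s by rewrite -s1 addrC addrK.
apply: convex_set_conv => //.
  by apply: Ay; rewrite lt_neqAle eq_sym lam_n lam0.
by rewrite ltW//= -s1 lerDl lam0.
Qed.

Section WeakConvexity.
Context {R : realType} {X : normedModType R}.

Lemma continuous_to_weak (T : topologicalType) (h : T -> weak X) :
  (forall l : dual X, continuous (fun t => l (h t) : R^o)) -> continuous h.
Proof. by move=> hl t; apply: cvg_to_weak => l; exact: hl. Qed.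

Lemma weak_sum_continuous n (y : 'I_n -> X) :
  continuous (fun lam : 'rV[R]_n => \sum_i lam ord0 i *: y i : weak X).
Proof.
apply: continuous_to_weak => l.
rewrite (_ : (fun _ => _) = fun lam : 'rV[R]_n => \sum_i (lam ord0 i * l (y i))).
  have mulc (T : topologicalType) (g : T -> R) c :
      continuous g -> continuous (fun x => g x * c).
    by move=> gc x; apply: cvgM; [exact: gc|exact: cvg_cst].
  by apply: sum_continuous => i; apply: mulc; exact: coord_continuous.
apply/funext => lam; rewrite linear_sum; apply: eq_bigr => i _.
by rewrite linearZ.
Qed.

Lemma weak_conv_continuous (t : R) :
  continuous (fun p : weak X * weak X => t *: p.1 + (1 - t) *: p.2 : weak X).
Proof.
apply: continuous_to_weak => l.
rewrite (_ : (fun _ => _) =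
  fun p : weak X * weak X => t * l p.1 + (1 - t) * l p.2).
  move=> p; apply: cvgD; (apply: cvgM; first exact: cvg_cst).
    apply: (@continuous_comp _ _ _ fst (l : weak X -> R^o) p); first exact: cvg_fst.
    exact: dual_weak_continuous.
  apply: (@continuous_comp _ _ _ snd (l : weak X -> R^o) p); first exact: cvg_snd.
  exact: dual_weak_continuous.
by apply/funext => p; rewrite linearD !linearZ.
Qed.

Lemma conv_lsegment (x y : X) (t : R) : 0 <= t <= 1 ->
  lsegment x y (t *: x + (1 - t) *: y).
Proof.
move=> /andP[t0 t1]; exists (1 - t).
  by rewrite /= in_itv/= subr_ge0 t1 gerBl t0.
have <- : x - (1 - t) *: x = t *: x.
  by rewrite -[X in X - _]scale1r -scalerBl subKr.
by rewrite scalerBr addrCA addrC.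
Qed.

Lemma lsegment_conv (x y z : X) : lsegment x y z ->
  exists2 t : R, 0 <= t <= 1 & z = t *: x + (1 - t) *: y.
Proof.
move=> [t]; rewrite /= in_itv/= => /andP[t0 t1] <-.
exists (1 - t); first by rewrite subr_ge0 t1 gerBl t0.
by rewrite subKr scalerBl scale1r scalerBr addrCA addrC.
Qed.

(** Approximate [x] and [y] by [a] and [b] in both sets. A combination of [a] and [b] is near that
    of [x] and [y], and near it the segment from [a] to [b] has a point of [D], which convexity puts
    in [S]. *)
Lemma convex_weak_closure (D S : set X) : convex_set S ->
  (forall x y, D x -> D y -> lsegment x y `<=`
    closure (lsegment x y `&` D : set (weak X))) ->
  convex_set (closure (D `&` S : set (weak X)) : set X).
Proof.
move=> cvxS segD x y t /set_mem clx /set_mem cly; apply/mem_set.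
suff conv_cl (s : R) : 0 <= s <= 1 ->
    closure (D `&` S : set (weak X)) (s *: x + (1 - s) *: y).
  by apply: conv_cl; rewrite ge0 le1.
move=> {t} s01 B.
rewrite nbhsE => -[W [opW Wx] WB].
have := @weak_conv_continuous s (x, y) W (open_nbhs_nbhs (conj opW Wx)).
move=> [[U V] /= [Ux Vy] UVW].
have [a [[Da Sa] Ua]] := clx U Ux.
have [b [[Db Sb] Vb]] := cly V Vy.
have /(segD a b Da Db) : lsegment a b (s *: a + (1 - s) *: b) by exact: conv_lsegment.
have Wc : W (s *: a + (1 - s) *: b) by exact: (UVW (a, b)).
move=> /(_ W (open_nbhs_nbhs (conj opW Wc)))[c [[abc Dc] Wcc]].
exists c; split; last exact: WB.
split => //; have [t t01 ->] := lsegment_conv abc.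
exact: convex_set_conv.
Qed.

End WeakConvexity.

(* A functional separating [x] and [y] turns weak neighbourhoods on the segment
   into intervals of the parameter [t]. *)
Lemma dense_segment_near (R : realType) (X : normedModType R) (D : set X)
    (x y : X) (e : R) :
  lsegment x y `<=` closure (lsegment x y `&` D : set (weak X)) ->
  x != y -> 0 < e ->
  exists t, [/\ 0 < t, t <= 1, t < e & D (t *: x + (1 - t) *: y)].
Proof.
move=> segD xy e0.
have [g gP [d d0 gy]] : exists2 g : X -> R^o, linear g /\ continuous g &
    exists2 d : R, 0 < d & forall a, [set y] a -> g a <= g x - d.
  apply: closed_convex_separation; last by move/eqP: xy.
  - move=> a b t /set_mem -> /set_mem ->; apply/mem_set.
    exact: (@convmm R (convex_lmodType X)).
  - by apply: compact_closed (@compact_set1 _ y); exact: norm_hausdorff.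
  - by exists y.
pose l := dual_of gP; pose m := Num.min 1 e.
have m0 : 0 < m by rewrite lt_min ltr01.
have m1 : m <= 1 by rewrite ge_min lexx.
have me : m <= e by rewrite ge_min lexx orbT.
have gxy : 0 < l x - l y by have := gy y erefl; rewrite /l /=; lra.
have lE t : l (t *: x + (1 - t) *: y) = l y + t * (l x - l y) :> R.
  have interp (p q : R) : t * p + (1 - t) * q = q + t * (p - q) by ring.
  by rewrite linearD !linearZ; exact: interp.
(* A neighbourhood of the parameter [m / 2] inside the interval from [0] to [m] keeps [t] positive
   and below both [1] and [e]. *)
pose w := (m / 2) *: x + (1 - m / 2) *: y.
have m2 : 0 < m / 2 < m by apply/andP; split; lra.
have : lsegment x y w by apply: conv_lsegment; lra.
have lt1 : \forall u \near (w : weak X), l y < l u :> R.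
  have /cvgr_gt := @dual_weak_continuous _ _ l w; apply.
  by rewrite lE ltrDl mulr_gt0//; case/andP: m2.
have lt2 : \forall u \near (w : weak X), l u < l y + m * (l x - l y) :> R.
  have /cvgr_lt := @dual_weak_continuous _ _ l w; apply.
  by rewrite lE ltrD2l ltr_pM2r//; case/andP: m2.
move=> /segD/(_ _ (filterI lt1 lt2))[_ [[/lsegment_conv[t /andP[t0 t1] ->] Dt]]].
move=> [lt_yu lt_um]; move: lt_yu lt_um.
rewrite lE ltrDl ltrD2l pmulr_lgt0// ltr_pM2r// => tgt0 tm.
by exists t; split => //; exact: lt_le_trans me.
Qed.

(** * Equilibria *)

Section NegativeCone.
Context {R : realType} {Z : lmodType R} (C : set Z).
Hypotheses (coneC : convex_cone C) (pointedC : pointed_cone C).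

Definition neg_cone : set Z := (-%R @` C) `\ 0.

Lemma neg_coneP z : neg_cone z <-> C (- z) /\ z != 0.
Proof.
split=> [[[c Cc <-] /eqP z0]|[Cz /eqP z0]]; first by rewrite opprK.
by split=> //; exists (- z); rewrite ?opprK.
Qed.

Lemma coneD a b : C a -> C b -> C (a + b).
Proof. by move=> Ca Cb; rewrite -coneC.2; exists a => //; exists b. Qed.

Lemma cone_opp_eq0 a : C a -> C (- a) -> a = 0.
Proof.
move=> Ca CNa; have : (C `&` (-%R @` C)) a.
  by split => //; exists (- a); rewrite ?opprK.
by rewrite pointedC.
Qed.

(** Pointedness keeps the sum away from [0]: otherwise [w = - z] would be in both [C] and [-C]. *)
Lemma neg_coneD z w : C (- z) -> neg_cone w -> neg_cone (z + w).
Proof.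
move=> Cz /neg_coneP[Cw w0]; apply/neg_coneP; split.
  by rewrite opprD; exact: coneD.
apply: contra w0 => /eqP/addr0_eq zw.
by apply/eqP/cone_opp_eq0 => //; rewrite -zw.
Qed.

Lemma neg_coneZ t z : 0 < t -> neg_cone z -> neg_cone (t *: z).
Proof.
move=> t0 /neg_coneP[Cz z0]; apply/neg_coneP; split.
  by rewrite -scalerN; apply: coneC.1 => //; exact: ltW.
by rewrite scaler_eq0 negb_or z0 gt_eqF.
Qed.

Lemma neg_cone_le z w : cone_le C z w -> neg_cone w -> neg_cone z.
Proof.
rewrite /cone_le => Czw negw; rewrite -[z](subrK w).
by apply: neg_coneD => //; rewrite opprB.
Qed.

Lemma convex_neg_cone : convex_set neg_cone.
Proof.
apply/convex_setW => x y /set_mem nx /set_mem ny t t0 t1; apply/mem_set.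
have [Cx _] := (neg_coneP x).1 nx.
apply: neg_coneD; last by apply: neg_coneZ => //; rewrite subr_gt0.
by rewrite -scalerN; apply: coneC.1 => //; exact: ltW.
Qed.

(** Semicontinuity is used with [k = - g x], which cancels [g x]. Thus the points where [g] avoids
    [neg_cone] form a relatively closed set. *)
Lemma strongly_C_usc_neg (T : topologicalType) (K : set T) (g : T -> Z) x :
  strongly_C_usc_at T C K g x -> neg_cone (g x) ->
  exists2 U, nbhs x U & forall u, U u -> K u -> neg_cone (g u).
Proof.
move=> gusc /neg_coneP[Cgx gx0].
have [|U xU Ug] := gusc (- g x).
  by split => //= /eqP; rewrite oppr_eq0 (negPf gx0).
exists U => // u Uu Ku; have [c [Cc /eqP c0] <-] := Ug u (conj Uu Ku).
by rewrite subrr sub0r; apply/neg_coneP; rewrite opprK oppr_eq0.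
Qed.

End NegativeCone.

Section Equilibrium.
Context {R : realType} {X : normedModType R} {Z : lmodType R}.
Variables (C : set Z) (K D : set X) (f : X -> X -> Z).
Hypotheses (coneC : convex_cone C) (pointedC : pointed_cone C).
Hypothesis convexK : convex_set K.
Hypothesis denseD : self_segment_dense (weak X) D K.
Hypothesis usc1 : forall y, D y ->
  strongly_C_usc_on (weak X) C K K (fun x => f x y).
Hypothesis convex2 : forall x, K x -> C_convex_on C D (fun y => f x y).
Hypothesis diag : forall x, D x -> ~ neg_cone C (f x x).

(** KKM for the sets pulled back to the simplex of weights. If the covering failed at [lam], all
    [f u (y i)] with positive weight would stay negative for [u] in [K] weakly near the combination.
    Some such [u] is in [D] and in the hull of these [y i], and [C]-convexity would make [f u u]
    negative, against [diag]. *)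
Lemma finite_equilibrium n (y : 'I_n.+1 -> X) : (forall i, D (y i)) ->
  exists2 lam : 'rV[R]_n.+1, simplex _ lam &
    forall i, ~ neg_cone C (f (\sum_j lam ord0 j *: y j) (y i)).
Proof.
move=> Dy; have [DK clD segD] := denseD.
pose pt (lam : 'rV[R]_n.+1) : weak X := \sum_j lam ord0 j *: y j.
have ptK lam : simplex _ lam -> K (pt lam).
  by move=> [lam0 lam1]; apply: convex_set_sum => // i _; exact/DK.
pose G i := [set lam : 'rV[R]_n.+1 | simplex _ lam /\ ~ neg_cone C (f (pt lam) (y i))].
have [||lam lamS lamG] := @kkm R n G; last first.
  by exists lam => // i; have [] := lamG i.
- move=> lam lamS; apply: contrapT => noG.
  have neg_y i : 0 < lam ord0 i -> neg_cone C (f (pt lam) (y i)).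
    move=> lam_i; apply: contrapT => Nneg; apply: noG.
    by exists i.
  have : \forall u \near pt lam, forall i, 0 < lam ord0 i -> K u ->
      neg_cone C (f u (y i)).
    apply: (filter_forall (nbhs_filter (pt lam))) => i.
    have [lam_i|] := boolP (0 < lam ord0 i); last first.
      by move=> /negP Nlam; apply: nearW.
    have [U ptU UK] := strongly_C_usc_neg (usc1 (Dy i) (ptK _ lamS)) (neg_y i lam_i).
    by apply: filterS ptU => u Uu _; exact: UK.
  (* The hull is restricted to the [y i] of positive weight in [lam], as negativity near the point
     is known only for these. *)
  pose S := [set \sum_i mu i *: y i | mu in
    [set mu : 'I_n.+1 -> R | [/\ forall i, 0 <= mu i, \sum_i mu i = 1 &
       forall i, 0 < mu i -> 0 < lam ord0 i]]].
  have cvxS : convex_set S.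
    apply/convex_setW => _ _ /set_mem[mu [mu0 mu1 mul] <-]
      /set_mem[nu [nu0 nu1 nul] <-] t t0 t1; apply/mem_set.
    exists (fun i => t%:num * mu i + (1 - t%:num) * nu i); first split.
    + by move=> i; rewrite addr_ge0// mulr_ge0// subr_ge0 ltW.
    + by rewrite big_split/= -!mulr_sumr mu1 nu1 !mulr1 addrC subrK.
    + move=> i; have [mui _|] := boolP (0 < mu i); first exact: mul.
      rewrite -leNgt => mui; have -> : mu i = 0 by apply/le_anti; rewrite mui mu0.
      by rewrite mulr0 add0r pmulr_rgt0 ?subr_gt0//; exact: nul.
    rewrite -[RHS]/(t%:num *: _ + (1 - t%:num) *: _) !scaler_sumr -big_split/=.
    by apply: eq_bigr => i _; rewrite !scalerA -scalerDl.
  have : closure (D `&` S : set (weak X)) (pt lam).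
    apply: convex_set_sum (convex_weak_closure cvxS segD) lamS.1 lamS.2 _ => i lam_i.
    apply: subset_closure; split => //.
    exists (fun j => (j == i)%:R); last first.
      rewrite (bigD1 i)//= eqxx scale1r big1 ?addr0// => j /negPf->.
      by rewrite scale0r.
    split=> [j||j]; first exact: ler0n.
      by rewrite (bigD1 i)//= eqxx big1 ?addr0// => j /negPf->.
    by case: eqP => [->//|_]; rewrite ltxx.
  move=> clS /clS[u [[Du [mu [mu0 mu1 mul] uE]] /= negu]].
  apply: (diag Du); apply: (neg_cone_le coneC pointedC (w := \sum_i mu i *: f u (y i))).
    rewrite -[X in f u X]uE; apply: convex2 => //; first exact: DK.
    by rewrite uE.
  apply: (convex_set_sum (convex_neg_cone coneC pointedC)) => // i mui.
  by apply: negu => //; [exact: mul|exact: DK].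
- move=> i lam cl_lam.
  have lamS : simplex _ lam.
    apply: (@compact_closed _ _ _ (@compact_simplex R n.+1)); first exact: norm_hausdorff.
    by move=> B /cl_lam[mu [[muS _] Bmu]]; exists mu.
  split=> // neg_i.
  have [U ptU UK] := strongly_C_usc_neg (usc1 (Dy i) (ptK _ lamS)) neg_i.
  have /cl_lam[mu [[muS Nmu] /= Umu]] := @weak_sum_continuous _ _ _ y lam U ptU.
  by apply: Nmu; apply: UK => //; exact: ptK.
Qed.

(** The solution sets for finite lists of points of [A] and [D] are nonempty by [finite_equilibrium]
    and generate a proper filter on [A]. A cluster point of it solves all the conditions, since each
    one is weakly closed in [K]. *)
Lemma compact_equilibrium (A : set X) : convex_set A -> A `<=` K ->
  (A `&` D) !=set0 -> compact (A : set (weak X)) ->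
  exists2 x, A x & forall y, A y -> D y -> ~ neg_cone C (f x y).
Proof.
move=> cvxA AK [y0 [Ay0 Dy0]] cptA.
pose F := filter_from [set s : seq X | forall y, y \in s -> A y /\ D y]
  (fun s => [set x : weak X | A x /\ forall y, y \in s -> ~ neg_cone C (f x y)]).
have FF : ProperFilter F.
  apply: filter_from_proper => [|s sAD].
    apply: filter_from_filter; first by exists [::].
    move=> s t sAD tAD; exists (s ++ t).
      by move=> y; rewrite mem_cat => /orP[/sAD|/tAD].
    move=> x [Ax xN]; split; split=> // y ys; apply: xN; rewrite mem_cat ys ?orbT//.
  (* Prepending [y0] supplies the one point that is required even when [s] is empty. *)
  pose y (i : 'I_(size s).+1) := nth y0 (y0 :: s) i.
  have yAD i : A (y i) /\ D (y i).
    have : y i \in y0 :: s by apply: mem_nth; exact: ltn_ord.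
    by rewrite inE => /predU1P[->//|/sAD].
  have [lam [lam0 lam1] lamN] := finite_equilibrium (fun i => (yAD i).2).
  exists (\sum_j lam ord0 j *: y j); split.
    by apply: convex_set_sum => // i _; have [] := yAD i.
  move=> z zs; have zi : (index z (y0 :: s) < (size s).+1)%N.
    by rewrite -[(size s).+1]/(size (y0 :: s)) index_mem inE zs orbT.
  have -> : z = y (Ordinal zi) by rewrite /y nth_index// inE zs orbT.
  exact: lamN.
have FA : F A by exists [::] => // x [].
have [x [Ax xF]] := cptA F FF FA.
exists x => // y Ay Dy neg_y.
have [U xU UK] := strongly_C_usc_neg (usc1 Dy (AK _ Ax)) neg_y.
have Fy : F [set x : weak X | A x /\ ~ neg_cone C (f x y)].
  exists [:: y] => [z|z [Az zN]]; first by rewrite inE => /eqP->.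
  by split => //; apply: zN; rewrite inE.
have [z [[Az zN] Uz]] := xF _ _ Fy xU.
by apply: zN; apply: UK => //; exact: AK.
Qed.

End Equilibrium.

(** * From the ball of radius [r] to all of [K] *)

Lemma C_convex_on2 (R : realType) (X Z : lmodType R) (C : set Z) (D : set X)
    (g : X -> Z) (x y : X) (t : R) :
  C_convex_on C D g -> D x -> D y -> 0 <= t <= 1 -> D (t *: x + (1 - t) *: y) ->
  cone_le C (g (t *: x + (1 - t) *: y)) (t *: g x + (1 - t) *: g y).
Proof.
move=> cvxg Dx Dy /andP[t0 t1] Dt.
pose z (i : 'I_2) := if i == ord0 then x else y.
pose lam (i : 'I_2) := if i == ord0 then t else 1 - t.
have sumE (E : lmodType R) (h : 'I_2 -> E) :
    \sum_i lam i *: h i = t *: h ord0 + (1 - t) *: h (lift ord0 ord0).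
  by rewrite big_ord_recl big_ord1.
have := cvxg 2 z lam; rewrite !sumE; apply => [i|i||//].
- by rewrite /z; case: ifP.
- by rewrite /lam; case: ifP => _ //; rewrite subr_ge0.
- by rewrite big_ord_recl big_ord1 /lam /= addrC subrK.
Qed.

Theorem theorem4p7 (R : realType) (X : completeNormedModType R) (Z : tvsType R)
    (C : set Z) (K D : set X) (f : X -> X -> Z)
    (reflX : reflexive_space X)
    (hausZ : hausdorff_space Z)
    (coneC : convex_cone C)
    (pointedC : pointed_cone C)
    (neK : K !=set0)
    (convexK : convex_set K)
    (closedK : closed K)
    (denseD : self_segment_dense (weak X) D K)
    (usc1 : forall y, D y ->
      strongly_C_usc_on (weak X) C K K (fun x => f x y))
    (usc2 : forall x, K x ->
      strongly_C_usc_on (weak X) C K (K `\` D) (fun y => f x y))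
    (convex2 : forall x, K x -> C_convex_on C D (fun y => f x y))
    (diag : forall x, D x -> ~ ((-%R @` C) `\ 0) (f x x))
    (coercive : exists2 r : R, 0 < r &
      (* The r-ball must meet K: otherwise the next clause is vacuous and the
         conclusion fails (K = D = [1, +oo[ and f x y = x - y, with r = 1/2). *)
      (exists2 x, K x & `|x| <= r) /\
      (forall x, K x -> `|x| <= r ->
        exists y0, [/\ D y0, `|y0| < r & (-%R @` C) (f x y0)])) :
  exists2 x0, K x0 & forall y, K y -> ~ ((-%R @` C) `\ 0) (f x0 y).
Proof.
have [DK clD segD] := denseD.
have [r r0 [[a Ka ar] coer]] := coercive.
pose A := K `&` [set x | `|x| <= r].
have convexA : convex_set A.
  move=> x y t /set_mem[Kx xr] /set_mem[Ky yr]; apply/mem_set; split.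
    by apply: set_mem; apply: convexK; exact: mem_set.
  rewrite /= -[conv _ _ _]/(t%:inum *: x + (1 - t%:inum) *: y).
  apply: le_trans (ler_normD _ _) _; rewrite !normrZ.
  have t0 : 0 <= t%:inum :> R by [].
  have t1 : 0 <= 1 - t%:inum :> R by rewrite subr_ge0.
  rewrite (ger0_norm t0) (ger0_norm t1).
  have := ler_wpM2l t0 xr; have := ler_wpM2l t1 yr; lra.
have closedA : closed A.
  apply: closedI => //; apply: (@preimage_closed _ _ (fun x : X => `|x|)) (@closed_le _ r).
  by move=> x _; exact: norm_continuous.
have cptA : compact (A : set (weak X)).
  by apply: (@convex_bounded_weak_compact _ _ A r reflX convexA closedA) => x [].
have AD0 : (A `&` D) !=set0.
  by have [y [Dy yr _]] := coer a Ka ar; exists y; split=> //; split; [exact: DK|exact: ltW].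
have [x0 [Kx0 x0r] x0A] := @compact_equilibrium _ _ _ _ _ _ f coneC pointedC
  convexK denseD usc1 convex2 diag A convexA (@subIsetl _ _ _) AD0 cptA.
have x0D y : D y -> ~ neg_cone C (f x0 y).
  move=> Dy neg_y; have [y0 [Dy0 y0r [c Cc cE]]] := coer x0 Kx0 x0r.
  have Cy0 : C (- f x0 y0) by rewrite -cE opprK.
  (* When the segment degenerates, [y] is itself in the ball. *)
  have [yy0|yy0] := eqVneq y y0.
    by apply: x0A neg_y => //; split; [exact: DK|rewrite yy0; exact: ltW].
  have y1 : 0 < `|y| + 1 by rewrite ltr_wpDl.
  (* Below this bound [t] times the norm of [y] is less than the room that [y0] leaves in the ball;
     the added [1] keeps the divisor positive. *)
  have e0 : 0 < (r - `|y0|) / (`|y| + 1) by rewrite divr_gt0 ?subr_gt0.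
  have [t [t0 t1 te Dt]] := dense_segment_near (segD _ _ Dy Dy0) yy0 e0.
  have t01 : 0 <= t <= 1 by rewrite ltW.
  have t1' : 0 <= 1 - t by rewrite subr_ge0.
  apply: (x0A (t *: y + (1 - t) *: y0)) => //.
    split; first exact: DK.
    rewrite /= (le_trans (ler_normD _ _))// !normrZ (gtr0_norm t0) (ger0_norm t1').
    have := mulr_ge0 (ltW t0) (normr_ge0 y0).
    move: te; rewrite (ltr_pdivlMr _ _ y1) mulrDr mulr1 mulrBl mul1r; lra.
  apply: (neg_cone_le coneC pointedC (C_convex_on2 (convex2 _ Kx0) Dy Dy0 t01 Dt)).
  (* The value at [y0] is only known to be in [-C]; nonzeroness comes from the value at [y], whose
     weight [t] is positive. *)
  rewrite addrC; apply: neg_coneD => //; last exact: neg_coneZ.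
  by rewrite -scalerN; exact: coneC.1.
exists x0 => // y Ky neg_y.
have [Dy|NDy] := pselect (D y); first exact: x0D Dy neg_y.
have [U yU UK] := strongly_C_usc_neg (usc2 _ Kx0 _ (conj Ky NDy)) neg_y.
have [z [Dz Uz]] := clD y Ky U yU.
exact: (x0D z Dz (UK z Uz (DK z Dz))).
Qed.
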